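(* Let $\alpha>0$ and let $P_0$ be a probability measure supported on $[-L_\theta,L_\theta]$, with scalar MMSE function $\mathrm{mmse}^*$ and threshold $\Delta_{\rm AMP}$ as defined in the context. For given noise level $\Delta>0$ and $t\ge0$, suppose that $(\Delta_0,E_0)$, with $\Delta_0\ge 0$ and $E_0\ge0$, satisfies $$E_0=\mathrm{mmse}^*\Big(\frac{\alpha}{\Delta+E_0}+t\Big)=\mathrm{mmse}^*\Big(\frac{\alpha}{\Delta_0+E_0}\Big).$$ Then $\Delta_0<\Delta_{\rm AMP}$ is a sufficient condition for $E=E_0$ to be the unique solution $E\ge0$ to $$E=\mathrm{mmse}^*\Big(\frac{\alpha}{\Delta+E}+t\Big).$$ In particular, $\Delta<\Delta_{\rm AMP}$ is a sufficient condition for $E=E_0$ to be the unique solution.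
   Context: For $s\ge0$, $\mathrm{mmse}^*(s)=\mathbb E|\theta-\mathbb E[\theta\mid\theta+s^{-1/2}\tilde G]|^2$ with $\theta\sim P_0$ and $\tilde G\sim\mathcal N(0,1)$ independent ($\mathrm{mmse}^*(0)=\mathrm{Var}(\theta)$, $\mathrm{mmse}^*(\infty)=0$). $\Delta_{\rm AMP}$ is the supremum of all $\Delta$ such that for every noise value $\Delta'\in[0,\Delta]$ the equation $E=\mathrm{mmse}^*(\alpha/(\Delta'+E))$ has a unique solution $E\ge0$. *)

(* Defs.v *)
From HB Require Import structures.
From mathcomp Require Import all_boot all_order all_algebra.
From mathcomp Require Import all_classical all_reals all_analysis.
Set Implicit Arguments.
Unset Strict Implicit.
Unset Printing Implicit Defensive.
Import Order.TTheory GRing.Theory Num.Theory.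
Import numFieldNormedType.Exports.
Local Open Scope classical_set_scope.
Local Open Scope ring_scope.

Definition is_cond_exp (d : measure_display) (T : measurableType d)
    (R : realType) (P : probability T R) (X Y Z : T -> R) : Prop :=
  [/\ forall B : set R, measurable B ->
        g_sigma_algebra_preimage Y (Z @^-1` B),
      P.-integrable [set: T] (EFin \o Z) &
      forall A : set T, g_sigma_algebra_preimage Y A ->
        (\int[P]_(w in A) (Z w)%:E = \int[P]_(w in A) (X w)%:E)%E].

(* A chosen version of E[X | Y]. One exists by Radon-Nikodym whenever X is
   integrable and Y is measurable, and two versions agree P-a.e. *)
Definition cond_exp (d : measure_display) (T : measurableType d)
    (R : realType) (P : probability T R) (X Y : T -> R) : T -> R :=
  xget (cst 0) [set Z | is_cond_exp P X Y Z].

(* The joint law of (theta, G): independent coordinates theta ~ P0 and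
   G ~ N(0, 1). measurableTypeR R is R with its Borel sets, the structure that
   carries normal_prob. *)
Definition joint_law (R : realType) (P0 : probability (measurableTypeR R) R) :
    probability (measurableTypeR R * measurableTypeR R)%type R :=
  (P0 \x normal_prob 0 1)%E.

Definition channel (R : realType) (s : R) (w : R * R) : R :=
  w.1 + (Num.sqrt s)^-1 * w.2.

(* Only s >= 0 is meaningful: the values at s < 0 and at -oo are junk. *)
Definition mmse (R : realType) (P0 : probability (measurableTypeR R) R)
    (s : \bar R) : R :=
  match s with
  | s%:E =>
      if s == 0 then fine 'V_P0[(idfun : measurableTypeR R -> R)]
      else fine 'E_(joint_law P0)
             [fun w => (w.1 - cond_exp (joint_law P0) fst (channel s) w) ^+ 2]
  | _ => 0
  end.

(* The division is that of \bar R, where 0^-1 = +oo: for alpha > 0 and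
   D + E = 0 the argument of mmse is +oo, or +oo + t = +oo. *)
Definition is_fixpoint (R : realType) (P0 : probability (measurableTypeR R) R)
    (alpha D t E : R) : Prop :=
  E = mmse P0 (alpha%:E / (D + E)%:E + t%:E)%E.

Definition unique_fixpoint (R : realType)
    (P0 : probability (measurableTypeR R) R) (alpha D t E : R) : Prop :=
  unique (fun E' : R => 0 <= E' /\ is_fixpoint P0 alpha D t E') E.

(* Negative D satisfy the condition vacuously, so the supremum is 0 when no
   D >= 0 qualifies; it may be +oo. *)
Definition Delta_AMP (R : realType) (P0 : probability (measurableTypeR R) R)
    (alpha : R) : \bar R :=
  ereal_sup [set D%:E | D in [set D : R |
    forall D' : R, 0 <= D' <= D ->
      exists E : R, unique_fixpoint P0 alpha D' 0 E]].

(* Main.v *)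
Require Import Defs.
From HB Require Import structures.
From mathcomp Require Import all_boot all_order all_algebra.
From mathcomp Require Import all_classical all_reals all_analysis.
From mathcomp Require Import measurable_realfun.
From mathcomp Require Import ring lra.
Set Implicit Arguments.
Unset Strict Implicit.
Unset Printing Implicit Defensive.
Import Order.TTheory GRing.Theory Num.Theory.
Import numFieldNormedType.Exports.
Local Open Scope classical_set_scope.
Local Open Scope ring_scope.

(** Write [M s] for the mmse at signal-to-noise ratio [s]. Two facts about [M]
    carry the proof: on [s > 0] it is nonnegative and bounded, and it is either
    identically [0] or strictly decreasing ([mmse_zero_or_decreasing]).

    Uniqueness from monotonicity. If [M] vanishes, [0] is the only fixed
    point. Otherwise [M] is positive and injective on [s > 0], so the two
    equations for [E0] force [alpha / (Delta0 + E0) = alpha / (Delta + E0) +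
    t] ([matched_snr]); in particular [Delta0 <= Delta], which reduces the
    second claim to the first. Let [E1] be another solution at [(Delta, t)].
    Since [z |-> alpha / z] is convex and decreasing, moving from [E0] to [E1]
    changes [alpha / (Delta0 + E)] by at least as much as [alpha / (Delta +
    E)] ([inv_gap_le]). So with [g E = M (alpha / (Delta0 + E))] one gets [E1
    <= g E1] when [E0 < E1], and [g E1 <= E1] when [E1 < E0]. The map [g] is
    nondecreasing and bounded, so by Knaster and Tarski it has a fixed point
    in [[E1, +oo[] in the first case and in [[0, E1]] in the second. That
    fixed point differs from [E0], against the uniqueness at noise [Delta0]
    granted by [Delta0 < Delta_AMP].

    Strict decrease. Almost surely [theta + L] equals a signal [u] with values
    in [[0, 2 * L]], and shifting does not change the mmse; a nonnegative signal
    lets all exchanges of integrals be instances of Tonelli. Bayes' formula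
    gives the posterior mean [f_s] of [u], which satisfies the defining property
    of conditional expectation ([ge0_post_mean_orthogonal]); any chosen version
    agrees with it almost everywhere, so [M s] is the Bayes error
    [E (u - f_s(Y_s)) ^ 2] ([mmse_bayes_error]), the least error of any
    estimator based on [Y_s] ([bayes_error_le]). For [s1 < s2], adding
    independent noise to [Y_s2] yields a copy of [Y_s1]; averaging
    [f_s1 (Y_s2 + noise)] over the noise is an estimator based on [Y_s2], and by
    Jensen it beats [f_s1 (Y_s1)], strictly if [f_s1] is injective
    ([bayes_error_lt]). Finally [f_s] is injective unless [u] is almost surely
    constant ([post_mean_injective]), in which case [M] vanishes. *)

(** * Gaussian integrals *)

Section gaussian_integrals.
Context {R : realType}.
Local Notation mu := (@lebesgue_measure R).
Implicit Types (m s : R) (F : measurableTypeR R -> \bar R).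

Lemma normal_pdf_gt0 m s x : s != 0 -> 0 < normal_pdf m s x.
Proof.
by move=> s0; rewrite normal_pdfE// mulr_gt0 ?normal_peak_gt0 ?expR_gt0.
Qed.

(** The normal law is defined by its density on sets only; the Radon-Nikodym
    derivative agrees with that density a.e. and transfers it to integrals. *)
Lemma ge0_integral_normal_prob m s F : measurable_fun setT F ->
    (forall x, (0 <= F x)%E) ->
  (\int[normal_prob m s]_x F x = \int[mu]_x (F x * (normal_pdf m s x)%:E))%E.
Proof.
move=> mF F0.
have dom := @normal_prob_dominates R m s.
rewrite -(Radon_Nikodym_SigmaFinite.change_of_variables dom)//.
pose g := Radon_Nikodym_SigmaFinite.f (normal_prob m s) mu.
have ig : mu.-integrable setT g.
  exact: Radon_Nikodym_SigmaFinite.f_integrable.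
have mp : measurable_fun setT (fun x => (normal_pdf m s x)%:E).
  by apply/measurable_EFinP; exact: measurable_normal_pdf.
apply: ae_eq_integral => //.
- by apply: emeasurable_funM => //; exact: measurable_int ig.
- by apply: emeasurable_funM.
have : ae_eq mu setT g (fun x => (normal_pdf m s x)%:E).
  apply: integral_ae_eq => // E _ mE.
  by rewrite -Radon_Nikodym_SigmaFinite.f_integral.
by apply: filterS => x gx _; rewrite -gx.
Qed.

Lemma measurable_affine m s :
  measurable_fun [set: measurableTypeR R]
    (fun x => m + s * x : measurableTypeR R).
Proof. by apply: measurable_funD => //; exact: measurable_funM. Qed.

(** By uniqueness of Lebesgue measure it suffices to compare the measures of
    half-open intervals. *)
Lemma ge0_integral_affine m s F : 0 < s -> measurable_fun setT F ->
    (forall x, (0 <= F x)%E) ->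
  (\int[mu]_x F x = s%:E * \int[mu]_x F (m + s * x)%R)%E.
Proof.
move=> s0 mF F0.
pose k : {nonneg R} := NngNum (ltW s0).
pose phi : measurableTypeR R -> measurableTypeR R := fun x => m + s * x.
have mphi : measurable_fun setT phi := measurable_affine m s.
pose nu_of : {measure set _ -> \bar R} := pushforward mu phi.
pose nu := nu_of mphi.
transitivity (\int[mscale k nu]_x F x)%E; last first.
  rewrite ge0_integral_mscale//; congr (_ * _)%E.
  by rewrite ge0_integral_pushforward.
apply: eq_measure_integral => A mA _.
apply: (@lebesgue_measure_unique R (mscale k nu)) => // _ [[a b]/= ab <-].
rewrite /mscale/= /pushforward /=.
have -> : phi @^-1` `]a, b]%classic = `](a - m) / s, (b - m) / s]%classic.
  apply/seteqP; split => x /=; rewrite !in_itv/= ltr_pdivrMr// ler_pdivlMr//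
    ltrBlDl lerBrDl /phi [x * s]mulrC//.
rewrite !lebesgue_measure_itv/= !lte_fin ltr_pM2r ?invr_gt0// ltrD2r.
case: ifP => _; last by rewrite mule0.
by rewrite -!EFinB -EFinM; congr EFin; field; rewrite gt_eqF.
Qed.

Lemma ge0_integral_normal_affine m s F : 0 < s -> measurable_fun setT F ->
    (forall x, (0 <= F x)%E) ->
  (\int[normal_prob 0 1]_x F (m + s * x)%R = \int[normal_prob m s]_x F x)%E.
Proof.
move=> s0 mF F0.
have mFa : measurable_fun setT (fun x : measurableTypeR R => F (m + s * x)%R).
  by apply: (measurableT_comp mF); exact: measurable_affine.
have mpdf m' s' : measurable_fun setT
    (fun x : measurableTypeR R => (normal_pdf m' s' x)%:E).
  by apply/measurable_EFinP; exact: measurable_normal_pdf.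
rewrite (ge0_integral_normal_prob 0 1 mFa (fun x => F0 _)).
rewrite (ge0_integral_normal_prob m s mF F0).
rewrite [RHS](ge0_integral_affine m s0)//; last 2 first.
- exact: emeasurable_funM.
- by move=> x; rewrite mule_ge0// lee_fin normal_pdf_ge0.
rewrite -ge0_integralZl_EFin//; last 3 first.
- by move=> x _; rewrite mule_ge0// lee_fin normal_pdf_ge0.
- apply: emeasurable_funM => //.
  by apply: (measurableT_comp (mpdf m s)); exact: measurable_affine.
- exact: ltW.
apply: eq_integral => x _; rewrite muleCA; congr (_ * _)%E.
rewrite -EFinM; congr EFin.
rewrite !normal_pdfE ?gt_eqF// /normal_peak /normal_fun.
rewrite mulrA; congr (_ * expR _); last by field; rewrite gt_eqF.
rewrite expr1n mul1r -mulrnAr sqrtrM ?sqr_ge0// sqrtr_sqr gtr0_norm// invfM.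
by rewrite mulrA divff ?gt_eqF// mul1r.
Qed.

(** Completing the square in [x]: the second factor on the right integrates to
    [1], so
    integrating over [x] leaves the density of the sum. *)
Lemma normal_pdf_convolution (s1 s2 s3 z x : R) :
    0 < s1 -> 0 < s2 -> 0 < s3 -> s1 ^+ 2 = s2 ^+ 2 + s3 ^+ 2 ->
  normal_pdf (s2 * x) s3 z * normal_pdf 0 1 x =
  normal_pdf 0 s1 z * normal_pdf (s2 * z / s1 ^+ 2) (s3 / s1) x.
Proof.
move=> s10 s20 s30 s123.
rewrite !normal_pdfE ?gt_eqF ?divr_gt0// /normal_peak /normal_fun.
rewrite mulrACA [RHS]mulrACA -!expRD; congr (_ * expR _).
  have sq r : 0 < r -> Num.sqrt (r ^+ 2 * pi *+ 2) = r * Num.sqrt (pi *+ 2).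
    by move=> r0; rewrite -mulrnAr sqrtrM ?sqr_ge0// sqrtr_sqr gtr0_norm.
  rewrite !sq ?divr_gt0//; field.
  by apply/and3P; split; rewrite gt_eqF// sqrtr_gt0 pmulrn_lgt0 ?pi_gt0.
have s3E : s3 ^+ 2 = s1 ^+ 2 - s2 ^+ 2 by rewrite s123; ring.
have s12 : s1 ^+ 2 - s2 ^+ 2 != 0 by rewrite -s3E expf_neq0 ?gt_eqF.
rewrite !sqrrB !expr_div_n !exprMn s3E.
by field; rewrite s12 gt_eqF.
Qed.

Lemma measurable_normal_pdf2 s : s != 0 ->
  measurable_fun [set: measurableTypeR R * measurableTypeR R]
    (fun w => normal_pdf w.1 s w.2).
Proof.
move=> s0.
rewrite (_ : (fun w => _) = (fun w : measurableTypeR R * measurableTypeR R =>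
   normal_peak s * expR (- (w.2 - w.1) ^+ 2 / (s ^+ 2 *+ 2)))); last first.
  by apply/funext => w; rewrite normal_pdfE.
apply: measurable_funM => //; apply: measurableT_comp => //=.
apply: measurable_funM => //; apply: measurableT_comp => //=.
by apply: measurable_funX; apply: measurable_funB.
Qed.

(** Independent centred noises of deviations [s2] and [s3] add up to one of
    deviation [s1]: an observation of lower quality is a noisy copy of one of
    higher quality. *)
Lemma ge0_integral_normal_sum (m s1 s2 s3 : R) F :
    0 < s1 -> 0 < s2 -> 0 < s3 -> s1 ^+ 2 = s2 ^+ 2 + s3 ^+ 2 ->
    measurable_fun setT F -> (forall x, (0 <= F x)%E) ->
  (\int[normal_prob 0 1]_x \int[normal_prob 0 1]_y
      F ((m + s2 * x) + s3 * y)%R =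
   \int[normal_prob 0 1]_x F (m + s1 * x)%R)%E.
Proof.
move=> s10 s20 s30 s123 mF F0.
have pdf0 m' s' x : (0 <= (normal_pdf m' s' x : R)%:E)%E.
  by rewrite lee_fin normal_pdf_ge0.
have mpdf2 : measurable_fun [set: measurableTypeR R * measurableTypeR R]
    (fun w => (normal_pdf (m + s2 * w.1) s3 w.2)%:E).
  apply/measurable_EFinP.
  have mg : measurable_fun [set: measurableTypeR R * measurableTypeR R]
      (fun w => (m + s2 * w.1, w.2) : measurableTypeR R * measurableTypeR R).
    apply/measurable_fun_pair => //=.
    by apply: measurable_funD => //; exact: measurable_funM.
  have s30' : s3 != 0 by rewrite gt_eqF.
  exact: (measurableT_comp (measurable_normal_pdf2 s30') mg).
have mpdf1 y : measurable_fun [set: measurableTypeR R]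
    (fun x => (normal_pdf (m + s2 * x) s3 y)%:E).
  exact: (measurableT_comp mpdf2 (pair2_measurable y)).
transitivity (\int[normal_prob 0 1]_x \int[mu]_y
    (F y * (normal_pdf (m + s2 * x) s3 y)%:E))%E.
  apply: eq_integral => x _.
  by rewrite ge0_integral_normal_affine// ge0_integral_normal_prob.
rewrite (@fubini_tonelli _ _ _ _ _ (normal_prob 0 1) mu
  (fun w : measurableTypeR R * measurableTypeR R =>
    F w.2 * (normal_pdf (m + s2 * w.1) s3 w.2)%:E)%E)/=; last 2 first.
- by apply: emeasurable_funM => //; exact: measurableT_comp.
- by move=> w; rewrite mule_ge0.
rewrite ge0_integral_normal_affine// ge0_integral_normal_prob//.
apply: eq_integral => y _.
rewrite ge0_integralZl//.
congr (_ * _)%E.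
rewrite ge0_integral_normal_prob//.
transitivity (\int[mu]_x ((normal_pdf m s1 y)%:E *
    (normal_pdf (s2 * (y - m) / s1 ^+ 2) (s3 / s1) x)%:E))%E.
  apply: eq_integral => x _; rewrite -!EFinM; congr EFin.
  have shift m' s' z : s' != 0 ->
      normal_pdf (m + m') s' z = normal_pdf m' s' (z - m).
    by move=> s'0; rewrite !normal_pdfE// /normal_fun opprD addrA.
  rewrite shift ?gt_eqF// (normal_pdf_convolution _ _ s10 s20 s30 s123).
  by have := shift 0 s1 y; rewrite addr0 gt_eqF// => ->.
rewrite ge0_integralZl// ?integral_normal_pdf ?mule1//.
by apply/measurable_EFinP; exact: measurable_normal_pdf.
Qed.
End gaussian_integrals.

(** * Bounded functions on a probability space *)

Section bounded_integrals.
Context d (T : measurableType d) (R : realType) (P : probability T R).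
Implicit Types f g : T -> R.

Lemma bounded_integrable (C : R) f : measurable_fun setT f ->
  (forall x, `|f x| <= C) -> P.-integrable setT (EFin \o f).
Proof.
move=> mf fC; have PT : (P setT < +oo)%E by rewrite probability_setT ltry.
apply: measurable_bounded_integrable => //.
exists C; split; first exact: num_real.
by move=> M CM x _; exact: le_trans (fC x) (ltW CM).
Qed.

Lemma ae_exists (Q : T -> Prop) : {ae P, forall x, Q x} -> exists x, Q x.
Proof.
move=> [A [mA A0 nQA]]; apply: contrapT => /forallNP nQ.
have AT : A = setT by apply/seteqP; split => // x _; apply: nQA => /nQ.
have : (1 = 0 :> \bar R)%E by rewrite -A0 AT probability_setT.
by move/eqP; rewrite onee_eq0.
Qed.

Lemma Rintegral_prob_cst (c : R) : \int[P]_x c = c.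
Proof.
transitivity (c * fine (P setT)); first exact: Rintegral_cst.
by rewrite probability_setT mulr1.
Qed.

Lemma Rintegral_eq0_ae f : (forall x, 0 <= f x) ->
    P.-integrable setT (EFin \o f) -> \int[P]_x f x = 0 ->
  {ae P, forall x, f x = 0}.
Proof.
move=> f0 fi If0.
have mf := measurable_int _ fi.
have : ae_eq P setT (EFin \o f) (cst 0%E).
  apply/(ae_eq_integral_abs P measurableT mf).
  have fin : (\int[P]_x (f x)%:E)%E \is a fin_num by exact: integrable_fin_num.
  rewrite (eq_integral (EFin \o f)); last first.
    by move=> x _; rewrite gee0_abs// lee_fin.
  by rewrite -[LHS](fineK fin) [fine _]If0.
by apply: filterS => x /(_ I)[].
Qed.

Lemma lt_Rintegral f g : (forall x, f x < g x) ->
    P.-integrable setT (EFin \o f) -> P.-integrable setT (EFin \o g) ->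
  \int[P]_x f x < \int[P]_x g x.
Proof.
move=> fg fi gi; rewrite lt_neqAle le_Rintegral ?andbT//; last first.
  by move=> x _; exact: ltW.
apply/eqP => fgE; have gfi : P.-integrable setT (EFin \o (g \- f)).
  by have := integrableB measurableT gi fi.
have /ae_exists[x /eqP] : {ae P, forall x, (g \- f) x = 0}.
  apply: Rintegral_eq0_ae => //; first by move=> x /=; rewrite subr_ge0 ltW.
  by rewrite RintegralB// fgE subrr.
by rewrite /= subr_eq0 gt_eqF.
Qed.

(** Strict Jensen for the square: the gap is the variance of [f], which vanishes
    only if [f] is a.e. constant. *)
Lemma sqr_Rintegral_lt (C a : R) f : measurable_fun setT f ->
    (forall x, `|f x| <= C) ->
    ~ {ae P, forall x, f x = \int[P]_x f x} ->
  (a - \int[P]_x f x) ^+ 2 < \int[P]_x (a - f x) ^+ 2.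
Proof.
move=> mf fC nconst; set m := \int[P]_x f x.
have fi := bounded_integrable mf fC.
have m2 b : measurable_fun setT (fun x => (b - f x) ^+ 2).
  by apply: measurable_funX; exact: measurable_funB.
have i2 b : P.-integrable setT (EFin \o (fun x => (b - f x) ^+ 2)).
  apply: (@bounded_integrable ((`|b| + C) ^+ 2)) => // x.
  rewrite normrX lerXn2r ?nnegrE ?addr_ge0//.
    exact: le_trans (fC x).
  by rewrite (le_trans (ler_normB _ _))// lerD2l.
have cst_i (c : R) : P.-integrable setT (EFin \o cst c).
  exact: (@bounded_integrable `|c|).
have If (b c : R) : \int[P]_x (b + c * f x) = b + c * m.
  have ci : P.-integrable setT (EFin \o (fun x => c * f x)).
    exact: (integrableZl measurableT c fi).
  rewrite RintegralD//; last exact: cst_i.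
  by rewrite RintegralZl// Rintegral_prob_cst.
have -> : \int[P]_x (a - f x) ^+ 2 =
    (a - m) ^+ 2 + \int[P]_x (m - f x) ^+ 2.
  transitivity (\int[P]_x ((a ^+ 2 - m ^+ 2 + (- ((a - m) *+ 2)) * f x) +
      (m - f x) ^+ 2)).
    by apply: eq_Rintegral => x _; ring.
  rewrite RintegralD// ?If; first last.
    apply: (@bounded_integrable (`|a ^+ 2 - m ^+ 2| + `|(a - m) *+ 2| * C)).
      by apply: measurable_funD => //; exact: measurable_funM.
    move=> x; rewrite (le_trans (ler_normD _ _))// lerD2l normrM normrN.
    by rewrite ler_wpM2l.
  by congr (_ + _); ring.
rewrite ltrDl lt_neqAle Rintegral_ge0 ?andbT; last first.
  by move=> x _; exact: sqr_ge0.
apply/eqP => /esym v0; apply: nconst.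
have := Rintegral_eq0_ae (fun x => sqr_ge0 _) (i2 m) v0.
by apply: filterS => x /eqP; rewrite sqrf_eq0 subr_eq0 => /eqP.
Qed.

End bounded_integrals.

Section bounded_measurable.
Context d (T : measurableType d) (R : realType).
Implicit Types f g : T -> R.

Definition bounded_measurable f :=
  measurable_fun setT f /\ exists C : R, forall x, `|f x| <= C.

Lemma bounded_measurable_cst (c : R) : bounded_measurable (cst c).
Proof. by split => //; exists `|c|. Qed.

Lemma bounded_measurableM f g : bounded_measurable f -> bounded_measurable g ->
  bounded_measurable (fun x => f x * g x).
Proof.
move=> [mf [C fC]] [mg [D gD]]; split; first exact: measurable_funM.
by exists (C * D) => x; rewrite normrM ler_pM.
Qed.

Lemma bounded_measurableB f g : bounded_measurable f -> bounded_measurable g ->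
  bounded_measurable (fun x => f x - g x).
Proof.
move=> [mf [C fC]] [mg [D gD]]; split; first exact: measurable_funB.
by exists (C + D) => x; rewrite (le_trans (ler_normB _ _))// lerD.
Qed.

Lemma bounded_measurable_sqr f : bounded_measurable f ->
  bounded_measurable (fun x => f x ^+ 2).
Proof.
move=> bf; rewrite (_ : (fun x => _) = (fun x => f x * f x)).
  exact: bounded_measurableM.
by apply/funext => x; rewrite expr2.
Qed.

Lemma bounded_measurable_integrable (P : probability T R) f :
  bounded_measurable f -> P.-integrable setT (EFin \o f).
Proof. by case=> mf [C fC]; exact: bounded_integrable fC. Qed.

End bounded_measurable.

(** * The posterior mean *)

Section posterior_mean.
Context {R : realType} (P0 : probability (measurableTypeR R) R).
Local Notation mu := (@lebesgue_measure R).
Local Notation RR := (measurableTypeR R * measurableTypeR R)%type.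

Lemma measurable_channel (s : R) : measurable_fun [set: RR] (channel s).
Proof.
by apply: measurable_funD => //; apply: measurable_funM.
Qed.

Definition likelihood (s y theta : R) : R := normal_pdf theta (Num.sqrt s)^-1 y.

Definition post_mean (u : measurableTypeR R -> R) (s y : R) : R :=
  \int[P0]_x (u x * likelihood s y x) / \int[P0]_x likelihood s y x.

(** Disintegration of the law of [(theta, Y)] along the observation [y]. *)
Lemma ge0_integral_joint_law (s : R) (H : RR -> \bar R) : 0 < s ->
    measurable_fun setT H -> (forall w, (0 <= H w)%E) ->
  (\int[joint_law P0]_w H (w.1, channel s w) =
   \int[mu]_y \int[P0]_x (H (x, y) * (likelihood s y x)%:E))%E.
Proof.
move=> s0 mH H0.
have sd0 : 0 < (Num.sqrt s)^-1 by rewrite invr_gt0 sqrtr_gt0.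
have mHc : measurable_fun [set: RR] (fun w => H (w.1, channel s w)).
  apply: (measurableT_comp mH); apply/measurable_fun_pair => //=.
  exact: measurable_channel.
have mlik : measurable_fun [set: RR]
    (fun w => (likelihood s w.2 w.1)%:E).
  by apply/measurable_EFinP; apply: measurable_normal_pdf2; rewrite gt_eqF.
have lik0 x y : (0 <= (likelihood s y x)%:E)%E.
  by rewrite lee_fin normal_pdf_ge0.
rewrite -(@fubini_tonelli _ _ _ _ _ P0 mu
  (fun w : RR => H w * (likelihood s w.2 w.1)%:E)%E)/=; last 2 first.
- exact: emeasurable_funM.
- by move=> w; rewrite mule_ge0.
rewrite (@fubini_tonelli1 _ _ _ _ _ P0 (normal_prob 0 1) _ mHc
  (fun w => H0 _)).
apply: eq_integral => x _; rewrite /fubini_F/channel/=.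
have mHx : measurable_fun [set: measurableTypeR R] (fun y => H (x, y)).
  exact: (measurableT_comp mH (pair1_measurable x)).
by rewrite (ge0_integral_normal_affine x sd0 mHx)// ge0_integral_normal_prob.
Qed.

Section bounded_signal.
Variables (K : R) (u : measurableTypeR R -> R).
Hypotheses (u_meas : measurable_fun setT u) (u0 : forall x, 0 <= u x)
  (uK : forall x, u x <= K).
Variable (s : R).
Hypothesis s0 : 0 < s.

Let sd0 : (Num.sqrt s)^-1 != 0.
Proof. by rewrite gt_eqF// invr_gt0 sqrtr_gt0. Qed.

Lemma likelihood_gt0 y x : 0 < likelihood s y x.
Proof. exact: normal_pdf_gt0. Qed.

Lemma measurable_likelihood : measurable_fun [set: RR]
  (fun w => likelihood s w.2 w.1).
Proof. exact: measurable_normal_pdf2. Qed.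

Lemma likelihood_ge0 y x : 0 <= likelihood s y x.
Proof. exact: normal_pdf_ge0. Qed.

Lemma likelihood_le y x : likelihood s y x <= normal_peak (Num.sqrt s)^-1.
Proof. exact: normal_pdf_ub. Qed.

Lemma likelihoodE y x : likelihood s y x = normal_peak (Num.sqrt s)^-1 *
  expR (- (y - x) ^+ 2 / ((Num.sqrt s)^-1 ^+ 2 *+ 2)).
Proof. by rewrite /likelihood normal_pdfE. Qed.

Opaque likelihood.

Lemma likelihood_integrable (v : measurableTypeR R -> R) (C : R) y :
    measurable_fun setT v -> (forall x, `|v x| <= C) ->
  P0.-integrable setT (EFin \o (fun x => v x * likelihood s y x)).
Proof.
move=> mv vC.
apply: (@bounded_integrable _ _ _ _ (C * normal_peak (Num.sqrt s)^-1)).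
  apply: measurable_funM => //.
  exact: (measurableT_comp measurable_likelihood (pair2_measurable y)).
move=> x; rewrite normrM ler_pM//.
by rewrite ger0_norm ?likelihood_ge0// likelihood_le.
Qed.

Lemma evidence_integrable y : P0.-integrable setT (EFin \o likelihood s y).
Proof.
have := @likelihood_integrable (cst 1) 1 y (@measurable_cst _ _ _ _ _ _) _.
rewrite (_ : (fun x => _) = likelihood s y); last first.
  by apply/funext => x; rewrite mul1r.
by apply => x; rewrite normr1.
Qed.

Let u_integrable y :
  P0.-integrable setT (EFin \o (fun x => u x * likelihood s y x)).
Proof. by apply: (@likelihood_integrable _ K) => // x; rewrite ger0_norm. Qed.

Lemma evidence_gt0 y : 0 < \int[P0]_x likelihood s y x.
Proof.
rewrite -(Rintegral_prob_cst P0 0); apply: lt_Rintegral.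
- exact: likelihood_gt0.
- by apply: (@bounded_integrable _ _ _ _ 0) => // x; rewrite normr0.
- exact: evidence_integrable.
Qed.

Lemma post_meanE y :
  post_mean u s y * \int[P0]_x likelihood s y x =
  \int[P0]_x (u x * likelihood s y x).
Proof. by rewrite divfK// gt_eqF// evidence_gt0. Qed.

Lemma post_mean_ge0 y : 0 <= post_mean u s y.
Proof.
rewrite divr_ge0 ?(ltW (evidence_gt0 y))// Rintegral_ge0// => x _.
by rewrite mulr_ge0// ltW// likelihood_gt0.
Qed.

Lemma post_mean_le y : post_mean u s y <= K.
Proof.
rewrite ler_pdivrMr ?evidence_gt0//.
rewrite -RintegralZl//; last exact: evidence_integrable.
apply: le_Rintegral => //.
  exact: (integrableZl measurableT K (evidence_integrable y)).
by move=> x _; rewrite ler_wpM2r// ltW// likelihood_gt0.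
Qed.

Lemma measurable_post_mean :
  measurable_fun [set: measurableTypeR R] (post_mean u s).
Proof.
have mI (v : measurableTypeR R -> R) :
    measurable_fun setT v -> (forall x, 0 <= v x) ->
    measurable_fun [set: measurableTypeR R]
      (fun y => \int[P0]_x (v x * likelihood s y x)).
  move=> mv v0; apply: measurableT_comp => //.
  apply: (@measurable_fun_fubini_tonelli_G _ _ _ _ _ P0
    (fun w : RR => (v w.1 * likelihood s w.2 w.1)%:E)).
    apply/measurable_EFinP; apply: measurable_funM.
      exact: measurableT_comp.
    exact: measurable_likelihood.
  by move=> w; rewrite lee_fin mulr_ge0// ltW// likelihood_gt0.
have -> : post_mean u s = fun y => \int[P0]_x (u x * likelihood s y x) *
    (\int[P0]_x (cst 1 x * likelihood s y x)) `^ (-1).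
  apply/funext => y; rewrite /post_mean; congr (_ * _).
  rewrite powR_inv1; last first.
    by apply: Rintegral_ge0 => x _; rewrite mul1r ltW// likelihood_gt0.
  by congr (_^-1); apply: eq_Rintegral => x _; rewrite mul1r.
apply: measurable_funM; first exact: mI.
apply: (measurableT_comp (measurable_powR (-1))).
by apply: mI => // x; exact: ler01.
Qed.

Opaque post_mean.

(** Orthogonality of the estimation error to functions of the observation. After
    disintegration it is Bayes' formula [post_meanE] at each fixed [y]. *)
Lemma ge0_post_mean_orthogonal (k : measurableTypeR R -> R) :
    measurable_fun setT k -> (forall y, 0 <= k y) ->
  (\int[joint_law P0]_w (u w.1 * k (channel s w))%:E =
   \int[joint_law P0]_w
     (post_mean u s (channel s w) * k (channel s w))%:E)%E.
Proof.
move=> mk k0.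
have mk2 : measurable_fun [set: RR] (fun w => k w.2).
  exact: measurableT_comp.
have mH1 : measurable_fun [set: RR] (fun w => (u w.1 * k w.2)%:E).
  apply/measurable_EFinP; apply: measurable_funM => //.
  exact: measurableT_comp.
have mH2 : measurable_fun [set: RR] (fun w => (post_mean u s w.2 * k w.2)%:E).
  apply/measurable_EFinP; apply: measurable_funM => //.
  exact: (measurableT_comp measurable_post_mean).
have H10 (w : RR) : (0 <= (u w.1 * k w.2)%:E)%E by rewrite lee_fin mulr_ge0.
have H20 (w : RR) : (0 <= (post_mean u s w.2 * k w.2)%:E)%E.
  by rewrite lee_fin mulr_ge0// post_mean_ge0.
rewrite (ge0_integral_joint_law s0 mH1 H10) (ge0_integral_joint_law s0 mH2 H20).
apply: eq_integral => y _ /=.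
have fin (v : measurableTypeR R -> R) :
    P0.-integrable setT (EFin \o (fun x => v x * likelihood s y x)) ->
    (\int[P0]_x ((v x * likelihood s y x)%:E))%E =
    (\int[P0]_x (v x * likelihood s y x))%:E.
  by move=> vi; rewrite fineK//; exact: integrable_fin_num.
have pull (v : measurableTypeR R -> R) : measurable_fun setT v ->
    (forall x, 0 <= v x <= K) ->
    (\int[P0]_x ((v x * k y)%:E * (likelihood s y x)%:E) =
     (k y * \int[P0]_x (v x * likelihood s y x))%:E)%E.
  move=> mv vK; rewrite EFinM -fin; last first.
    apply: (@likelihood_integrable _ K) => // x.
    by case/andP: (vK x) => v0 ?; rewrite ger0_norm.
  rewrite -ge0_integralZl_EFin//.
  - by apply: eq_integral => x _; rewrite -!EFinM; congr EFin; ring.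
  - move=> x _; case/andP: (vK x) => ? _.
    by rewrite lee_fin mulr_ge0 ?likelihood_ge0.
  - apply/measurable_EFinP; apply: measurable_funM => //.
    exact: (measurableT_comp measurable_likelihood (pair2_measurable y)).
rewrite (pull u)//; last by move=> x; rewrite u0 uK.
rewrite (pull (cst (post_mean u s y)))//; last first.
  by move=> x; rewrite post_mean_ge0 post_mean_le.
rewrite RintegralZl//; last exact: evidence_integrable.
by rewrite post_meanE.
Qed.
End bounded_signal.
End posterior_mean.

(** * The Bayes error *)

Section joint.
Context {R : realType} (P0 : probability (measurableTypeR R) R).
Local Notation RR := (measurableTypeR R * measurableTypeR R)%type.

Lemma ae_joint_law_fst (Q : measurableTypeR R -> Prop) :
  {ae P0, forall x, Q x} -> {ae joint_law P0, forall w, Q w.1}.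
Proof.
move=> [A [mA A0 nQA]]; exists (A `*` setT); split.
- exact: measurableX.
- transitivity ((P0 \x normal_prob 0 1)%E (A `*` setT)); first by [].
  rewrite product_measure1E// -[RHS](mul0e (normal_prob 0 1 setT)).
  by congr (_ * _)%E.
- by move=> w /= nQ; split => //; exact: nQA.
Qed.

Lemma normal_prob_ae_neq (m s : R) (g0 : R) :
  {ae normal_prob m s, forall g, g <> g0}.
Proof.
exists [set g0]; split; first exact: measurable_set1.
  have /null_content_dominatesP dom := @normal_prob_dominates R m s.
  by apply: dom => //; exact: lebesgue_measure_set1.
by move=> g /= /contrapT.
Qed.

Definition bayes_error (u : measurableTypeR R -> R) (s : R) : R :=
  \int[joint_law P0]_w (u w.1 - post_mean P0 u s (channel s w)) ^+ 2.

Section bounded_signal.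
Variables (K : R) (u : measurableTypeR R -> R).
Hypotheses (u_meas : measurable_fun setT u) (u0 : forall x, 0 <= u x)
  (uK : forall x, u x <= K).

Let K0 : 0 <= K := le_trans (u0 0) (uK 0).

Lemma bounded_measurable_signal : @bounded_measurable _ RR R (fun w => u w.1).
Proof.
split; first exact: measurableT_comp.
by exists K => w; rewrite ger0_norm.
Qed.

Lemma bounded_measurable_channel (h : measurableTypeR R -> R) (C s : R) :
    measurable_fun setT h -> (forall y, 0 <= h y <= C) ->
  @bounded_measurable _ RR R (fun w => h (channel s w)).
Proof.
move=> mh h0; split; first exact: measurableT_comp (measurable_channel s).
by exists C => w; case/andP: (h0 (channel s w)) => ? ?; rewrite ger0_norm.
Qed.

Lemma bayes_error_ge0 s : 0 <= bayes_error u s.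
Proof. by apply: Rintegral_ge0 => w _; exact: sqr_ge0. Qed.

(** The posterior mean is the best estimator, by Pythagoras: the error of [h]
    exceeds the Bayes error by the mean square of [post_mean - h], because the
    cross term integrates to [0]. *)
Lemma bayes_error_le (h : measurableTypeR R -> R) (C s : R) : 0 < s ->
    measurable_fun setT h -> (forall y, 0 <= h y <= C) ->
  bayes_error u s <= \int[joint_law P0]_w (u w.1 - h (channel s w)) ^+ 2.
Proof.
move=> s0 mh h0.
pose f := post_mean P0 u s.
have mf : measurable_fun setT f by exact: measurable_post_mean.
have f0 y : 0 <= f y <= K.
  by rewrite post_mean_ge0//= (post_mean_le P0 u_meas).
pose U (w : RR) := u w.1; pose F (w : RR) := f (channel s w).
pose H (w : RR) := h (channel s w).
have bF : bounded_measurable F by exact: (@bounded_measurable_channel f K s).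
have bH : bounded_measurable H by exact: (@bounded_measurable_channel h C s).
have orth (k : measurableTypeR R -> R) D : measurable_fun setT k ->
    (forall y, 0 <= k y <= D) ->
    \int[joint_law P0]_w (U w * k (channel s w)) =
    \int[joint_law P0]_w (F w * k (channel s w)).
  move=> mk k0; congr fine.
  apply: (ge0_post_mean_orthogonal P0 u_meas u0 uK) => // y.
  by case/andP: (k0 y).
have intB (a b : RR -> R) : bounded_measurable a -> bounded_measurable b ->
    \int[joint_law P0]_w (a w - b w) =
    \int[joint_law P0]_w a w - \int[joint_law P0]_w b w.
  by move=> ba bb; rewrite RintegralB//; exact: bounded_measurable_integrable.
have bM := @bounded_measurableM _ RR R.
have bB := @bounded_measurableB _ RR R.
have bS := @bounded_measurable_sqr _ RR R.
pose cross w := (U w * F w - F w * F w) - (U w * H w - F w * H w).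
have bU : bounded_measurable U by exact: bounded_measurable_signal.
have bcross : bounded_measurable cross.
  by apply: (bB (fun w => U w * F w - F w * F w)); apply: bB; exact: bM.
have Icross : \int[joint_law P0]_w cross w = 0.
  rewrite intB; [|by apply: bB; exact: bM..].
  rewrite !intB; [|by exact: bM..].
  by rewrite (orth h C mh h0) (orth f K mf f0) !subrr.
have -> : bayes_error u s =
    \int[joint_law P0]_w ((((U w - H w) ^+ 2 - (F w - H w) ^+ 2) - cross w) -
      cross w).
  by apply: eq_Rintegral => w _; rewrite /cross /F /H /U /f; ring.
have bX : bounded_measurable (fun w => (U w - H w) ^+ 2) by exact/bS/bB.
have bY : bounded_measurable (fun w => (F w - H w) ^+ 2) by exact/bS/bB.
have bZ := bB _ _ bX bY.
rewrite (intB _ _ (bB _ _ bZ bcross) bcross) (intB _ _ bZ bcross).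
rewrite (intB _ _ bX bY).
rewrite Icross !subr0 lerBlDr lerDl.
by apply: Rintegral_ge0 => w _; exact: sqr_ge0.
Qed.

Lemma bayes_error_degenerate (c s : R) : 0 < s -> 0 <= c ->
  {ae P0, forall x, u x = c} -> bayes_error u s = 0.
Proof.
move=> s0 c0 /ae_joint_law_fst uc.
apply/eqP; rewrite eq_le bayes_error_ge0 andbT.
apply: (le_trans (@bayes_error_le (cst c) c s s0 _ _)) => //=.
  by move=> _; rewrite c0 lexx.
rewrite le_eqVlt; apply/orP; left; apply/eqP.
rewrite -[RHS](Rintegral_prob_cst (joint_law P0) 0); congr fine.
apply: ae_eq_integral => //.
  by apply/measurable_EFinP; have [] := bounded_measurable_sqr
    (bounded_measurableB bounded_measurable_signal
      (@bounded_measurable_cst _ RR R c)).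
by apply: filterS uc => w /= -> _; rewrite subrr expr0n.
Qed.

End bounded_signal.
End joint.

(** * Strict decrease in the signal-to-noise ratio *)

Section strict_decrease.
Context {R : realType} (P0 : probability (measurableTypeR R) R).
Local Notation RR := (measurableTypeR R * measurableTypeR R)%type.

(** Averaging the optimal estimator at [s1] over the extra noise that degrades
    [Y_s2] to [Y_s1] gives an estimator [h] based on [Y_s2] whose error is
    strictly smaller, pointwise by Jensen. *)
Lemma bayes_error_lt (K : R) (u : measurableTypeR R -> R) (s1 s2 : R) :
    measurable_fun setT u -> (forall x, 0 <= u x) -> (forall x, u x <= K) ->
    0 < s1 -> s1 < s2 -> injective (post_mean P0 u s1) ->
  bayes_error P0 u s2 < bayes_error P0 u s1.
Proof.
move=> u_meas u0 uK s10 s12 inj.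
have s20 : 0 < s2 := lt_trans s10 s12.
pose N : probability (measurableTypeR R) R := normal_prob 0 1.
pose sd (s : R) := (Num.sqrt s)^-1.
have sd_gt0 s : 0 < s -> 0 < sd s by move=> ?; rewrite invr_gt0 sqrtr_gt0.
have sd_sq s : 0 < s -> sd s ^+ 2 = s^-1.
  by move=> ?; rewrite exprVn sqr_sqrtr// ltW.
(* [r] is the deviation of the extra noise. *)
pose r := Num.sqrt (s1^-1 - s2^-1).
have r_gt0 : 0 < r by rewrite sqrtr_gt0 subr_gt0 ltf_pV2.
have r_sq : sd s1 ^+ 2 = sd s2 ^+ 2 + r ^+ 2.
  rewrite !sd_sq// sqr_sqrtr; first by rewrite addrC subrK.
  by rewrite subr_ge0 lef_pV2// ltW.
have [f fE] : {f | f = post_mean P0 u s1} by exists (post_mean P0 u s1).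
rewrite -fE in inj.
have mf : measurable_fun [set: measurableTypeR R] f.
  by rewrite fE; exact: measurable_post_mean.
have f0 y : 0 <= f y <= K.
  by rewrite fE post_mean_ge0//= (post_mean_le P0 u_meas).
have f_norm y : `|f y| <= K by case/andP: (f0 y) => ? ?; rewrite ger0_norm.
have mfr y : measurable_fun [set: measurableTypeR R] (fun g => f (y + r * g)).
  by apply: measurableT_comp => //; exact: measurable_affine.
pose h y := \int[N]_g f (y + r * g).
have fri y : N.-integrable setT (EFin \o (fun g => f (y + r * g))).
  by apply: (@bounded_integrable _ _ _ _ K) => // g; exact: f_norm.
have h0 y : 0 <= h y <= K.
  rewrite Rintegral_ge0/=; last by move=> g _; case/andP: (f0 (y + r * g)).
  rewrite -(Rintegral_prob_cst N K); apply: le_Rintegral => //.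
    exact: (bounded_measurable_integrable N (@bounded_measurable_cst _ _ _ K)).
  by move=> g _; case/andP: (f0 (y + r * g)).
have madd : measurable_fun [set: RR]
    (fun w => w.1 + r * w.2 : measurableTypeR R).
  by apply: measurable_funD => //; exact: measurable_funM.
have mh : measurable_fun [set: measurableTypeR R] h.
  apply: measurableT_comp => //.
  apply: (@measurable_fun_fubini_tonelli_F _ _ _ _ _ N
    (fun w : RR => (f (w.1 + r * w.2))%:E)).
    by apply/measurable_EFinP; exact: (measurableT_comp mf).
  by move=> w; rewrite lee_fin; case/andP: (f0 (w.1 + r * w.2)).
apply: (le_lt_trans (bayes_error_le P0 u_meas u0 uK s20 mh h0)).
pose Q (w : RR) := \int[N]_g (u w.1 - f (channel s2 w + r * g)) ^+ 2.
have bh : @bounded_measurable _ RR R (fun w => (u w.1 - h (channel s2 w)) ^+ 2).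
  apply: bounded_measurable_sqr; apply: bounded_measurableB.
    exact: bounded_measurable_signal u_meas u0 uK.
  exact: bounded_measurable_channel h0.
pose q (z : RR * measurableTypeR R) :=
  ((u z.1.1 - f (channel s2 z.1 + r * z.2)) ^+ 2)%:E.
have mq : measurable_fun setT q.
  apply/measurable_EFinP; apply: measurable_funX; apply: measurable_funB.
    apply: (measurableT_comp u_meas).
    by apply: measurableT_comp.
  apply: (measurableT_comp mf); apply: measurable_funD.
    by apply: (measurableT_comp (measurable_channel s2)).
  by apply: measurable_funM.
have q0 z : (0 <= q z)%E by rewrite lee_fin sqr_ge0.
have bq w : @bounded_measurable _ (measurableTypeR R) R
    (fun g => (u w.1 - f (channel s2 w + r * g)) ^+ 2).
  apply: bounded_measurable_sqr; apply: bounded_measurableB.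
    exact: bounded_measurable_cst.
  by split => //; exists K => g; exact: f_norm.
have mIq : measurable_fun [set: RR] (fun w => \int[N]_g q (w, g))%E.
  exact: (@measurable_fun_fubini_tonelli_F _ _ _ _ _ N q mq q0).
have QE w : (\int[N]_g q (w, g))%E = (Q w)%:E.
  rewrite fineK//; apply: integrable_fin_num => //.
  exact: bounded_measurable_integrable (bq w).
have Q0 w : 0 <= Q w by apply: Rintegral_ge0 => g _; exact: sqr_ge0.
have bQ : bounded_measurable Q.
  split.
    exact: (measurableT_comp (fine_measurable measurableT) mIq).
  exists (K ^+ 2) => w; rewrite ger0_norm//.
  rewrite -(Rintegral_prob_cst N (K ^+ 2)); apply: le_Rintegral => //.
  - exact: bounded_measurable_integrable (bq w).
  - exact: (bounded_measurable_integrable N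
      (@bounded_measurable_cst _ _ _ (K ^+ 2))).
  - move=> g _; have /andP[f1 f2] := f0 (channel s2 w + r * g).
    rewrite -[leLHS]real_normK ?num_real// lerXn2r ?nnegrE//.
      exact: le_trans (u0 0) (uK 0).
    rewrite ler_norml; have := u0 w.1; have := uK w.1; lra.
apply: (@lt_le_trans _ _ (\int[joint_law P0]_w Q w)).
  apply: lt_Rintegral; [|exact: bounded_measurable_integrable..].
  move=> w; apply: (@sqr_Rintegral_lt _ _ _ N K) => //.
  (* An a.e. constant estimate would take the same value at two distinct
     samples of the atomless extra noise. *)
  move=> fc; have /ae_exists[g1 fg1] := fc.
  have /ae_exists[g2 []] : {ae N, forall g, f (channel s2 w + r * g) =
      \int[N]_g f (channel s2 w + r * g) /\ g <> g1}.
    by apply: filterS2 fc (normal_prob_ae_neq 0 1 g1) => g.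
  rewrite -fg1 => /inj/addrI/mulfI g21; apply.
  by apply: g21; rewrite gt_eqF.
rewrite le_eqVlt; apply/orP; left; apply/eqP.
rewrite /bayes_error -fE; congr fine.
have mf2 x : measurable_fun [set: measurableTypeR R]
    (fun y => ((u x - f y) ^+ 2)%:E).
  by apply/measurable_EFinP; apply: measurable_funX; exact: measurable_funB.
transitivity (\int[P0]_x \int[N]_a ((u x - f (x + sd s1 * a)) ^+ 2)%:E)%E.
  under eq_integral do rewrite -QE.
  rewrite (@fubini_tonelli1 _ _ _ _ _ P0 N
    (fun w => \int[N]_g q (w, g))%E)/=; last 2 first.
  - exact: mIq.
  - by move=> w; exact: integral_ge0.
  apply: eq_integral => x _.
  have := @ge0_integral_normal_sum R x (sd s1) (sd s2) r _ (sd_gt0 _ s10)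
    (sd_gt0 _ s20) r_gt0 r_sq (mf2 x); apply => y.
  by rewrite lee_fin sqr_ge0.
have mw : measurable_fun [set: RR]
    (fun w => ((u w.1 - f (channel s1 w)) ^+ 2)%:E).
  apply/measurable_EFinP; apply: measurable_funX; apply: measurable_funB.
    exact: measurableT_comp.
  exact: (measurableT_comp mf (measurable_channel s1)).
rewrite (@fubini_tonelli1 _ _ _ _ _ P0 N _ mw)// => w.
by rewrite lee_fin sqr_ge0.
Qed.

End strict_decrease.

(** * Injectivity of the posterior mean *)

Section injectivity.
Context {R : realType} (P0 : probability (measurableTypeR R) R).
Variables (K : R) (u : measurableTypeR R -> R).
Hypotheses (u_meas : measurable_fun setT u) (u0 : forall x, 0 <= u x)
  (uK : forall x, u x <= K).

(** Equal posterior means [c] at [y1 < y2] make [u - c] orthogonal to both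
    likelihoods. After rescaling these are [W x * exp (y * (x - p) / v)], so
    [u - c] integrates to [0] against
    [W x * (exp (y2 * (x - p) / v) - exp (y1 * (x - p) / v))], which has
    the sign of [x - p]. When [u - c] changes sign only at [p], the integrand is
    nonnegative and vanishes only where [u = c]. *)
Lemma post_mean_eq_degenerate (s c p y1 y2 : R) : 0 < s -> 0 <= c <= K ->
    (forall x, u x < c -> x < p) -> (forall x, c < u x -> p < x) ->
    y1 < y2 -> post_mean P0 u s y1 = c -> post_mean P0 u s y2 = c ->
  {ae P0, forall x, u x = c}.
Proof.
move=> s0 /andP[c0 cK] u_lt u_gt y12 y1c y2c.
have ucK x : `|u x - c| <= K.
  rewrite ler_norml lerBrDr lerBlDr (le_trans _ (u0 x)) ?(le_trans (uK x))//.
    by rewrite lerDl.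
  by rewrite addrC subr_le0.
have uK' x : `|u x| <= K by rewrite ger0_norm.
have muc : measurable_fun [set: measurableTypeR R] (fun x => u x - c).
  exact: measurable_funB.
have uci y := likelihood_integrable P0 s0 y muc ucK.
have ucE y : post_mean P0 u s y = c ->
    \int[P0]_x ((u x - c) * likelihood s y x) = 0.
  move=> cy; have := post_meanE P0 u s0 y; rewrite cy => pE.
  have ei := evidence_integrable P0 s0 y.
  under eq_Rintegral do rewrite mulrBl.
  have ui := likelihood_integrable P0 s0 y u_meas uK'.
  rewrite (RintegralB measurableT ui (integrableZl measurableT c ei)).
  by rewrite (RintegralZl _ measurableT ei) pE subrr.
have sd2 : 0 < (Num.sqrt s)^-1 ^+ 2 by rewrite exprn_gt0// invr_gt0 sqrtr_gt0.
have peak : 0 < normal_peak (Num.sqrt s)^-1.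
  by rewrite normal_peak_gt0// gt_eqF// invr_gt0 sqrtr_gt0.
pose W x := normal_peak (Num.sqrt s)^-1 *
  expR (- x ^+ 2 / ((Num.sqrt s)^-1 ^+ 2 *+ 2)).
have W0 x : 0 < W x by rewrite mulr_gt0 ?expR_gt0.
have [v v0 vE] : exists2 v : R, 0 < v & forall y, exists b, forall x,
    b * likelihood s y x = W x * expR (y * (x - p) / v).
  exists ((Num.sqrt s)^-1 ^+ 2) => // y.
  exists (expR (y ^+ 2 / ((Num.sqrt s)^-1 ^+ 2 *+ 2) -
    y * p / (Num.sqrt s)^-1 ^+ 2)) => x.
  rewrite likelihoodE// /W mulrCA -!mulrA -!expRD; congr (_ * expR _).
  move: sd2; set v := _ ^+ 2 => v0; by field; rewrite gt_eqF.
move: (vE y1) (vE y2) => [b1 b1E] [b2 b2E].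
pose F x := (u x - c) * (b2 * likelihood s y2 x - b1 * likelihood s y1 x).
have FE x : F x = (u x - c) *
    (W x * (expR (y2 * (x - p) / v) - expR (y1 * (x - p) / v))).
  by rewrite /F b1E b2E -mulrBr.
have F_gt0 x : u x != c -> 0 < F x.
  rewrite FE neq_lt => /orP[uc|uc].
    have xp := u_lt x uc.
    rewrite nmulr_rgt0 ?subr_lt0// pmulr_rlt0// subr_lt0 ltr_expR.
    by rewrite ltr_pM2r ?invr_gt0// ltr_nM2r// subr_lt0.
  have xp := u_gt x uc.
  rewrite pmulr_rgt0 ?subr_gt0// pmulr_rgt0// subr_gt0 ltr_expR.
  by rewrite ltr_pM2r ?invr_gt0// ltr_pM2r// subr_gt0.
have F_ge0 x : 0 <= F x.
  have [uc|/F_gt0/ltW//] := eqVneq (u x) c.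
  by rewrite /F uc subrr mul0r.
have FB : F = (fun x => b2 * ((u x - c) * likelihood s y2 x) -
    b1 * ((u x - c) * likelihood s y1 x)).
  by apply/funext => x; rewrite /F; ring.
have i1 := integrableZl measurableT b1 (uci y1).
have i2 := integrableZl measurableT b2 (uci y2).
have Fi : P0.-integrable setT (EFin \o F).
  by rewrite FB; exact: (integrableB measurableT i2 i1).
have IF : \int[P0]_x F x = 0.
  rewrite FB (RintegralB measurableT i2 i1).
  rewrite (RintegralZl _ measurableT (uci y2)).
  rewrite (RintegralZl _ measurableT (uci y1)).
  by rewrite (ucE _ y1c) (ucE _ y2c) !mulr0 subrr.
have := @Rintegral_eq0_ae _ (measurableTypeR R) R P0 F F_ge0 Fi IF.
apply: filterS => x Fx0.
by apply/eqP/negPn/negP => /F_gt0; rewrite Fx0 ltxx.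
Qed.

(** The crossing hypothesis says that [u] goes from below [c] to above [c] at a
    single point [p]; a clipped affine function does so, although it is not
    injective. *)
Lemma post_mean_injective (s : R) : 0 < s ->
    (forall c, 0 <= c <= K -> exists p,
      (forall x, u x < c -> x < p) /\ (forall x, c < u x -> p < x)) ->
    ~ (exists2 c, 0 <= c & {ae P0, forall x, u x = c}) ->
  injective (post_mean P0 u s).
Proof.
move=> s0 cross nondeg.
have half y1 y2 : y1 < y2 -> post_mean P0 u s y1 <> post_mean P0 u s y2.
  move=> y12 /esym y2c.
  have c0 := post_mean_ge0 P0 u0 s0 y1.
  have cK := post_mean_le P0 u_meas u0 uK s0 y1.
  have cb : 0 <= post_mean P0 u s y1 <= K by rewrite c0 cK.
  have [p [plt pgt]] := cross _ cb.
  apply: nondeg; exists (post_mean P0 u s y1); first exact: c0.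
  exact: (post_mean_eq_degenerate s0 cb plt pgt y12 erefl y2c).
move=> y1 y2 y12; case: (ltgtP y1 y2) => [lt12|lt21|y12E].
- by have := half _ _ lt12 y12.
- by have := half _ _ lt21 (esym y12).
- exact: y12E.
Qed.

End injectivity.

Section clipped_signal.
Context {R : realType}.

(** Equal to [x + L] on the support [[- L, L]], clipped to [[0, 2 * L]] so as to
    be bounded and nonnegative everywhere. *)
Definition clipped_shift (L x : R) : R :=
  Num.max 0 (Num.min (x + L) (L *+ 2)).

Lemma measurable_clipped_shift (L : R) :
  measurable_fun setT (clipped_shift L : measurableTypeR R -> R).
Proof.
apply: measurable_maxr => //; apply: measurable_minr => //.
by apply: measurable_funD.
Qed.

Lemma clipped_shift_ge0 (L x : R) : 0 <= clipped_shift L x.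
Proof. by rewrite /clipped_shift le_max lexx. Qed.

Lemma clipped_shift_le (L x : R) : 0 <= L -> clipped_shift L x <= L *+ 2.
Proof.
by move=> L0; rewrite /clipped_shift ge_max mulrn_wge0//= ge_min lexx orbT.
Qed.

Lemma clipped_shiftE (L x : R) : - L <= x <= L -> clipped_shift L x = x + L.
Proof.
move=> /andP[Lx xL]; rewrite /clipped_shift min_l ?max_r//.
  by rewrite -lerBlDr sub0r.
by rewrite mulr2n lerD2r.
Qed.

Lemma clipped_shift_gt (L x c : R) : 0 <= c ->
  c < clipped_shift L x -> c - L < x.
Proof.
move=> c0; rewrite /clipped_shift lt_max ltNge c0/= lt_min ltrBlDr.
by move=> /andP[].
Qed.

Lemma clipped_shift_lt (L x c : R) : c <= L *+ 2 ->
  clipped_shift L x < c -> x < c - L.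
Proof.
move=> cL; rewrite /clipped_shift gt_max gt_min ltrBrDr => /andP[_ /orP[//|]].
by rewrite ltNge cL.
Qed.

Lemma clipped_shift_crossing (L c : R) : 0 <= c <= L *+ 2 ->
  exists p, (forall x, clipped_shift L x < c -> x < p) /\
    (forall x, c < clipped_shift L x -> p < x).
Proof.
move=> /andP[c0 cL]; exists (c - L); split=> x.
  exact: clipped_shift_lt.
exact: clipped_shift_gt.
Qed.

End clipped_signal.
Opaque clipped_shift.

(** * The mmse as a Bayes error *)

Section conditional_expectation.
Context d (T : measurableType d) (R : realType) (P : probability T R).
Implicit Types X Y Z : T -> R.

Lemma measurable_preimage_sigma Y : measurable_fun setT Y ->
  forall A, g_sigma_algebra_preimage Y A -> measurable A.
Proof. by move=> mY A [B mB <-]; exact: mY. Qed.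

(** Both versions are measurable for the sigma-algebra generated by [Y], so
    equality of their integrals over its sets identifies them almost
    everywhere for the restriction of [P] to that sigma-algebra, realized as the
    image of [P] under the identity. *)
Lemma is_cond_exp_ae_unique X Y Z1 Z2 : measurable_fun setT Y ->
    is_cond_exp P X Y Z1 -> is_cond_exp P X Y Z2 ->
  {ae P, forall w, Z1 w = Z2 w}.
Proof.
move=> mY [mZ1 iZ1 Z1E] [mZ2 iZ2 Z2E].
pose TY := g_sigma_algebra_preimageType Y.
pose phi : T -> TY := id.
have mphi : measurable_fun setT phi.
  by move=> _ A mA; rewrite setTI; exact: measurable_preimage_sigma mA.
pose PY_of : {measure set TY -> \bar R} := pushforward P phi.
pose PY := PY_of mphi.
have mTY Z : (forall B : set R, measurable B ->
    g_sigma_algebra_preimage Y (Z @^-1` B)) ->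
  measurable_fun [set: TY] (EFin \o (Z : TY -> R)).
  by move=> mZ; apply/measurable_EFinP => _ B mB; rewrite setTI; exact: mZ.
have iTY Z : (forall B : set R, measurable B ->
    g_sigma_algebra_preimage Y (Z @^-1` B)) ->
    P.-integrable setT (EFin \o Z) ->
  PY.-integrable [set: TY] (EFin \o (Z : TY -> R)).
  move=> mZ iZ; exact: (integrable_pushforward mphi (mTY Z mZ)).
have : ae_eq PY setT (EFin \o (Z1 : TY -> R)) (EFin \o (Z2 : TY -> R)).
  apply: integral_ae_eq => //; [exact: iTY|exact: mTY|].
  move=> A _ mA.
  have mA' : measurable (A : set T) by exact: measurable_preimage_sigma mA.
  rewrite (integral_pushforward mphi)//; last 2 first.
  - exact: mTY.
  - exact: (integrableS measurableT mA' (@subsetT _ _) iZ1).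
  rewrite (integral_pushforward mphi)//; last 2 first.
  - exact: mTY.
  - exact: (integrableS measurableT mA' (@subsetT _ _) iZ2).
  by rewrite (Z1E A mA) (Z2E A mA).
case=> A [mA A0 nA]; exists A; split => //.
  exact: measurable_preimage_sigma mA.
by move=> w nZ; apply: nA => ZE; apply: nZ; have [] := ZE I.
Qed.

Lemma is_cond_exp_cond_exp X Y Z :
  is_cond_exp P X Y Z -> is_cond_exp P X Y (cond_exp P X Y).
Proof. by move=> ZE; apply: (xgetPex (cst 0)); exists Z. Qed.

End conditional_expectation.

Section mmse_bayes_error.
Context {R : realType} (P0 : probability (measurableTypeR R) R) (L : R).
Local Notation RR := (measurableTypeR R * measurableTypeR R)%type.
Hypothesis supp : P0 `[- L, L]%classic = 1%E.

Lemma support_radius_ge0 : 0 <= L.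
Proof.
rewrite leNgt; apply/negP => L0; move: supp.
rewrite set_itv_ge ?measure0; last by rewrite bnd_simp -ltNge; lra.
by move/eqP; rewrite eq_sym onee_eq0.
Qed.

Lemma ae_clipped_shift : {ae P0, forall x, clipped_shift L x = x + L}.
Proof.
exists (~` `[- L, L]%classic); split.
- exact: measurableC.
- by rewrite probability_setC// supp subee.
- move=> x /=; apply: contra_not; rewrite in_itv/=; exact: clipped_shiftE.
Qed.

Variable s : R.
Hypothesis s0 : 0 < s.

Let u := clipped_shift L.
Let u_meas : measurable_fun [set: measurableTypeR R] u.
Proof. exact: measurable_clipped_shift. Qed.
Let u0 x : 0 <= u x. Proof. exact: clipped_shift_ge0. Qed.
Let uK x : u x <= L *+ 2.
Proof. exact: clipped_shift_le support_radius_ge0. Qed.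
Let f := post_mean P0 u s.
Let mf : measurable_fun [set: measurableTypeR R] f.
Proof. exact: measurable_post_mean. Qed.
Let f0 y : 0 <= f y <= L *+ 2.
Proof. by rewrite post_mean_ge0//= (post_mean_le P0 u_meas). Qed.

Lemma post_mean_is_cond_exp :
  is_cond_exp (joint_law P0) fst (channel s) (fun w => f (channel s w) - L).
Proof.
have bf : @bounded_measurable _ RR R (fun w => f (channel s w)).
  exact: bounded_measurable_channel f0.
have bu : @bounded_measurable _ RR R (fun w => u w.1).
  exact: bounded_measurable_signal u_meas u0 uK.
have bL := @bounded_measurable_cst _ RR R L.
split.
- move=> B mB; exists ((fun y => f y - L) @^-1` B); last by rewrite setTI.
  rewrite -[X in measurable X]setTI.
  by apply: (measurable_funB mf (measurable_cst L)).
- exact: bounded_measurable_integrable (bounded_measurableB bf bL).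
move=> _ [B mB <-]; rewrite setTI.
have mA : measurable (channel s @^-1` B : set RR).
  by rewrite -[X in measurable X]setTI; exact: measurable_channel.
have onA (g : RR -> R) : bounded_measurable g ->
    (joint_law P0).-integrable (channel s @^-1` B) (EFin \o g).
  move=> bg; apply: (integrableS measurableT mA) => //.
  exact: bounded_measurable_integrable.
transitivity (\int[joint_law P0]_(w in channel s @^-1` B) (u w.1 - L)%:E)%E.
  under eq_integral do rewrite EFinB.
  under [RHS]eq_integral do rewrite EFinB.
  rewrite !integralB_EFin//=.
  - congr (_ - _)%E.
    rewrite integral_mkcond [RHS]integral_mkcond/=.
    have patch_indic (g : RR -> R) :
        (fun w => (g w)%:E) \_ (channel s @^-1` B) =
        fun w => (g w * \1_B (channel s w))%:E.
      apply/funext => w; rewrite patchE indicE.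
      rewrite -[w \in _]/(channel s w \in B).
      by case: (_ \in _); rewrite ?mulr1 ?mulr0.
    rewrite !patch_indic; apply/esym.
    apply: (ge0_post_mean_orthogonal P0 u_meas u0 uK s0) => //.
  - exact: onA bu.
  - exact: onA bL.
  - exact: onA bf.
  - exact: onA bL.
apply: ae_eq_integral => //.
- by have [/measurable_EFinP/measurable_funTS] := bounded_measurableB bu bL.
- by apply/measurable_EFinP; exact: measurable_funTS.
have uae := ae_joint_law_fst ae_clipped_shift.
by apply: filterS uae => w uw _; rewrite /u uw addrK.
Qed.

Lemma mmse_bayes_error : mmse P0 s%:E = bayes_error P0 u s.
Proof.
rewrite /mmse gt_eqF// unlock /bayes_error; congr fine.
have mchan := measurable_channel s.
have ce := post_mean_is_cond_exp.
have ce' := is_cond_exp_cond_exp ce.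
have Zae := is_cond_exp_ae_unique mchan ce' ce.
have uae := ae_joint_law_fst ae_clipped_shift.
apply: ae_eq_integral => //.
- have [_ iZ _] := ce'.
  apply/measurable_EFinP; apply: measurable_funX; apply: measurable_funB => //.
  by move: (measurable_int _ iZ) => /measurable_EFinP.
- apply/measurable_EFinP; apply: measurable_funX; apply: measurable_funB.
    exact: measurableT_comp.
  exact: measurableT_comp mf mchan.
apply: filterS2 Zae uae => w /= -> uw _; rewrite /f /u uw.
by congr (_%:E); ring.
Qed.
End mmse_bayes_error.

(** * Fixed points *)

(** Knaster-Tarski: the supremum of the points [x] with [x <= g x] is fixed. *)
Lemma nondecreasing_fixpoint (R : realType) (g : R -> R) (a b : R) :
    a <= b -> a <= g a -> g b <= b ->
    (forall x y, a <= x -> x <= y -> y <= b -> g x <= g y) ->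
  exists x, [/\ a <= x, x <= b & g x = x].
Proof.
move=> ab aga gbb gmono.
pose S := [set x | a <= x <= b /\ x <= g x].
have Sa : S a by split; rewrite ?lexx.
have ubSb : ubound S b by move=> x [/andP[]].
have hS : has_sup S by split; [exists a|exists b].
have asup : a <= sup S by apply: ub_le_sup => //; exists b.
have supb : sup S <= b by apply: ge_sup => //; exists a.
have sup_le : sup S <= g (sup S).
  apply: ge_sup; first by exists a.
  move=> x [/andP[ax xb] xgx]; apply: (le_trans xgx); apply: gmono => //.
  by apply: ub_le_sup => //; [exists b|split => //; rewrite ax].
exists (sup S); split => //; apply/eqP; rewrite eq_le sup_le andbT.
have gsb : g (sup S) <= b by apply: le_trans gbb; exact: gmono.
apply: ub_le_sup; first by exists b.
split; first by rewrite gsb andbT (le_trans asup).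
exact: gmono.
Qed.

(** Convexity of the inverse: a step [e] costs more at the smaller point. *)
Lemma inv_gap_le (R : realType) (x y e : R) : 0 < y -> y <= x -> 0 <= e ->
  x^-1 - (x + e)^-1 <= y^-1 - (y + e)^-1.
Proof.
move=> y0 yx e0; have x0 := lt_le_trans y0 yx.
have gapE z : 0 < z -> z^-1 - (z + e)^-1 = e / (z * (z + e)).
  by move=> z0; field; rewrite !gt_eqF// ltr_wpDr.
rewrite !gapE// ler_wpM2l// lef_pV2 ?posrE ?mulr_gt0 ?ltr_wpDr//.
by rewrite ler_pM ?lerD2r ?addr_ge0// ltW.
Qed.

Lemma mmse_ge0 (R : realType) (P0 : probability (measurableTypeR R) R) (s : R) :
  0 < s -> 0 <= mmse P0 s%:E.
Proof.
move=> s0; rewrite /mmse gt_eqF// fine_ge0// expectation_ge0// => w.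
exact: sqr_ge0.
Qed.

Section mmse_monotone.
Context {R : realType} (P0 : probability (measurableTypeR R) R) (L : R).
Hypothesis supp : P0 `[- L, L]%classic = 1%E.
Let L0 : 0 <= L := support_radius_ge0 supp.
Local Notation u := (clipped_shift L : measurableTypeR R -> R).
Let u_meas := measurable_clipped_shift L.
Let u0 x : 0 <= u x := clipped_shift_ge0 L x.
Let uK x : u x <= L *+ 2 := clipped_shift_le x L0.

(** The constant estimator [0] gives a bound independent of [s]. *)
Lemma mmse_ub : exists C, forall s, 0 < s -> mmse P0 s%:E <= C.
Proof.
exists (\int[joint_law P0]_w (u w.1 - 0) ^+ 2) => s s0.
rewrite (mmse_bayes_error supp)//.
apply: (@bayes_error_le _ _ _ _ u_meas u0 uK (cst 0) 0) => // y.
by rewrite lexx.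
Qed.

(** The first case is that of a [P0] concentrated at one point. *)
Lemma mmse_zero_or_decreasing :
  (forall s, 0 < s -> mmse P0 s%:E = 0) \/
  (forall s1 s2, 0 < s1 -> s1 < s2 -> mmse P0 s2%:E < mmse P0 s1%:E).
Proof.
have [[c c0 uc]|nondeg] :=
    pselect (exists2 c : R, 0 <= c & {ae P0, forall x, u x = c}); [left|right].
  move=> s s0; rewrite (mmse_bayes_error supp)//.
  exact: (bayes_error_degenerate u_meas u0 uK s0 c0 uc).
move=> s1 s2 s10 s12; have s20 := lt_trans s10 s12.
rewrite !(mmse_bayes_error supp)//.
apply: (bayes_error_lt u_meas u0 uK s10 s12).
apply: (post_mean_injective u_meas u0 uK s10) nondeg => c.
exact: clipped_shift_crossing.
Qed.

End mmse_monotone.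

Section fixpoints.
Context {R : realType} (P0 : probability (measurableTypeR R) R).
Implicit Types alpha D t E : R.

Lemma is_fixpointE alpha D t E : 0 < D + E ->
  is_fixpoint P0 alpha D t E <-> E = mmse P0 (alpha / (D + E) + t)%:E.
Proof. by move=> DE; rewrite /is_fixpoint inver gt_eqF. Qed.

Lemma lt_Delta_AMP alpha D E E' : 0 <= D ->
    (D%:E < Delta_AMP P0 alpha)%E -> 0 <= E -> 0 <= E' ->
    is_fixpoint P0 alpha D 0 E -> is_fixpoint P0 alpha D 0 E' ->
  E = E'.
Proof.
move=> D0 /ereal_sup_gt[_ [D' D'u <-]]; rewrite lte_fin => DD' E0 E'0 fE fE'.
have [|e [_ ue]] := D'u D; first by rewrite D0 ltW.
by rewrite -(ue E)// -(ue E').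
Qed.

End fixpoints.
Section uniqueness.
Context {R : realType} (P0 : probability (measurableTypeR R) R) (L : R).
Hypothesis supp : P0 `[- L, L]%classic = 1%E.
Variable alpha : R.
Hypothesis alpha_gt0 : 0 < alpha.

Let arg_gt0 (x t : R) : 0 < x -> 0 <= t -> 0 < alpha / x + t.
Proof. by move=> x0 t0; rewrite ltr_wpDr// divr_gt0. Qed.

Lemma unique_fixpoint_zero (D t E : R) : 0 < D -> 0 <= t -> 0 <= E ->
    (forall s, 0 < s -> mmse P0 s%:E = 0) -> is_fixpoint P0 alpha D t E ->
  unique_fixpoint P0 alpha D t E.
Proof.
move=> D0 t0 E0 M0 fE.
have all0 E' : 0 <= E' -> is_fixpoint P0 alpha D t E' -> E' = 0.
  move=> E'0; have DE' : 0 < D + E' by rewrite ltr_wpDr.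
  by move=> /(is_fixpointE _ _ _ DE') ->; rewrite M0// arg_gt0.
by split => // E' [E'0 fE']; rewrite (all0 E)// (all0 E').
Qed.

Section strict.
Hypothesis decr :
  forall s1 s2, 0 < s1 -> s1 < s2 -> mmse P0 s2%:E < mmse P0 s1%:E.

Lemma mmse_gt0 s : 0 < s -> 0 < mmse P0 s%:E.
Proof.
move=> s0; apply: (le_lt_trans (mmse_ge0 P0 (ltr_wpDr ler01 s0))).
by apply: decr => //; rewrite ltrDl.
Qed.

Lemma mmse_noninc s1 s2 : 0 < s1 -> s1 <= s2 ->
  mmse P0 s2%:E <= mmse P0 s1%:E.
Proof.
move=> s0; rewrite le_eqVlt => /orP[/eqP -> //|s12].
by rewrite ltW// decr.
Qed.

Lemma mmse_inj s1 s2 : 0 < s1 -> 0 < s2 -> mmse P0 s1%:E = mmse P0 s2%:E ->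
  s1 = s2.
Proof.
move=> s10 s20 ME; have [lt12|lt21|//] := ltgtP s1 s2.
  by have := decr s10 lt12; rewrite ME ltxx.
by have := decr s20 lt21; rewrite ME ltxx.
Qed.

Lemma fixpoint_gt0 (D t E : R) : 0 < D -> 0 <= t -> 0 <= E ->
  is_fixpoint P0 alpha D t E -> 0 < E.
Proof.
move=> D0 t0 E0; have DE : 0 < D + E by rewrite ltr_wpDr.
by move=> /(is_fixpointE _ _ _ DE) ->; rewrite mmse_gt0// arg_gt0.
Qed.

Let mmse_at0 x : x = 0 -> mmse P0 (alpha%:E / x%:E + 0%:E)%E = 0.
Proof. by move=> ->; rewrite inver eqxx gt0_muley ?lte_fin. Qed.

Let mmse_at_gt0 x : 0 < x ->
  mmse P0 (alpha%:E / x%:E + 0%:E)%E = mmse P0 (alpha / x)%:E.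
Proof. by move=> x0; rewrite inver gt_eqF// -EFinM -EFinD addr0. Qed.

Let mmse_at_ge0 x : 0 <= x -> 0 <= mmse P0 (alpha%:E / x%:E + 0%:E)%E.
Proof.
rewrite le_eqVlt => /orP[/eqP/esym/mmse_at0 ->//|x0].
by rewrite mmse_at_gt0// mmse_ge0// divr_gt0.
Qed.

(** At [D = E = 0] the argument is [+oo], where the mmse takes its least
    value [0]; this keeps monotonicity up to the endpoint. *)
Lemma fixpoint_map_nondecreasing (D E E' : R) : 0 <= D -> 0 <= E -> E <= E' ->
  mmse P0 (alpha%:E / (D + E)%:E + 0%:E)%E <=
  mmse P0 (alpha%:E / (D + E')%:E + 0%:E)%E.
Proof.
move=> D0 E0 EE'.
have : 0 <= D + E by rewrite addr_ge0.
rewrite le_eqVlt => /orP[/eqP/esym DE|DE].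
  by rewrite (mmse_at0 DE) mmse_at_ge0// addr_ge0// (le_trans E0).
have DE' : 0 < D + E' by apply: (lt_le_trans DE); rewrite lerD2l.
rewrite !mmse_at_gt0//; apply: mmse_noninc; first by rewrite divr_gt0.
by rewrite ler_pM2l// lef_pV2 ?posrE// lerD2l.
Qed.

Section two_noise_levels.
Variables (D t D0 E0 : R).
Hypotheses (D_gt0 : 0 < D) (t_ge0 : 0 <= t) (D0_ge0 : 0 <= D0)
  (E0_ge0 : 0 <= E0) (fE : is_fixpoint P0 alpha D t E0)
  (fE0 : is_fixpoint P0 alpha D0 0 E0).

Let E0_gt0 : 0 < E0 := fixpoint_gt0 D_gt0 t_ge0 E0_ge0 fE.
Let x0 : 0 < D + E0. Proof. by rewrite ltr_wpDr. Qed.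
Let y0 : 0 < D0 + E0. Proof. by rewrite ltr_wpDl. Qed.

Lemma matched_snr : alpha / (D0 + E0) = alpha / (D + E0) + t.
Proof.
apply: mmse_inj; rewrite ?divr_gt0 ?arg_gt0//.
move: fE fE0 => /(is_fixpointE _ _ _ x0) <- /(is_fixpointE _ _ _ y0).
by rewrite addr0 => <-.
Qed.

Lemma matched_noise_le : D0 <= D.
Proof.
rewrite -(lerD2r E0) -[leRHS]invrK -[leLHS]invrK lef_pV2 ?posrE ?invr_gt0//.
by rewrite -(ler_pM2l alpha_gt0) matched_snr lerDl.
Qed.

(** A second solution [E1] makes [E1 <= g E1] or [g E1 <= E1] at noise [D0],
    hence produces a fixed point of [g] on the same side of [E0] as [E1]. *)
Lemma matched_noise_unique : (D0%:E < Delta_AMP P0 alpha)%E ->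
  unique_fixpoint P0 alpha D t E0.
Proof.
move=> D0_lt; split => // E1 [E1_ge0 fE1].
pose g E := mmse P0 (alpha%:E / (D0 + E)%:E + 0%:E)%E.
have g_mono x y : 0 <= x -> x <= y -> g x <= g y.
  exact: fixpoint_map_nondecreasing.
have g_uniq x : 0 <= x -> g x = x -> x = E0.
  by move=> x_ge0 gx; apply: (lt_Delta_AMP D0_ge0 D0_lt).
have E1_gt0 : 0 < E1 := fixpoint_gt0 D_gt0 t_ge0 E1_ge0 fE1.
have x1 : 0 < D + E1 by rewrite ltr_wpDr.
have y1 : 0 < D0 + E1 by rewrite ltr_wpDl.
have ME1 : E1 = mmse P0 (alpha / (D + E1) + t)%:E.
  exact/(is_fixpointE _ _ _ x1).
have gE1 : g E1 = mmse P0 (alpha / (D0 + E1))%:E.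
  exact: mmse_at_gt0.
have gap a b : 0 < D0 + a -> a <= b ->
    alpha / (D + a) - alpha / (D + b) <= alpha / (D0 + a) - alpha / (D0 + b).
  move=> y_gt0 ab; rewrite -!mulrBr ler_pM2l//.
  have bE z : z + b = z + a + (b - a) by ring.
  rewrite !bE; apply: inv_gap_le; rewrite ?lerD2r ?subr_ge0//.
  exact: matched_noise_le.
have snr0 := matched_snr.
have [E1_gt|E1_lt|//] := ltgtP E0 E1; exfalso.
- have [C MC] := mmse_ub supp.
  (* Above [b] the bounded map [g] lies below the diagonal. *)
  pose b := Num.max E1 C.
  have E1b : E1 <= b by rewrite le_max lexx.
  have b_ge0 : 0 <= b by rewrite (le_trans E1_ge0).
  have yb : 0 < D0 + b by rewrite (lt_le_trans y1)// lerD2l.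
  have [||x y xx xy _|x [E1x _ gx]] := @nondecreasing_fixpoint _ g E1 b E1b.
  + rewrite gE1 {1}ME1; apply: mmse_noninc; first by rewrite divr_gt0.
    by have := gap _ _ y0 (ltW E1_gt); lra.
  + rewrite /g mmse_at_gt0// le_max MC ?orbT//.
    by rewrite divr_gt0.
  + by apply: g_mono => //; exact: le_trans xx.
  + have := g_uniq x (le_trans E1_ge0 E1x) gx => xE.
    by move: E1x; rewrite xE leNgt E1_gt.
- have [||x y xx xy _|x [x_ge0 xE1 gx]] :=
    @nondecreasing_fixpoint _ g 0 E1 E1_ge0.
  + by rewrite mmse_at_ge0// addr0.
  + rewrite gE1 [leRHS]ME1; apply: mmse_noninc; first by rewrite arg_gt0.
    by have := gap _ _ y1 (ltW E1_lt); lra.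
  + exact: g_mono.
  + by move: xE1; rewrite (g_uniq x x_ge0 gx) leNgt E1_lt.
Qed.

End two_noise_levels.
End strict.
End uniqueness.

Theorem proposition1 (R : realType) (alpha L : R)
    (P0 : probability (measurableTypeR R) R)
    (Delta t Delta0 E0 : R)
    (alpha_gt0 : 0 < alpha)
    (P0_supp : P0 `[- L, L]%classic = 1%E)
    (Delta_gt0 : 0 < Delta) (t_ge0 : 0 <= t)
    (Delta0_ge0 : 0 <= Delta0) (E0_ge0 : 0 <= E0)
    (E0_fix : is_fixpoint P0 alpha Delta t E0)
    (E0_fix0 : is_fixpoint P0 alpha Delta0 0 E0) :
  ((Delta0%:E < Delta_AMP P0 alpha)%E ->
     unique_fixpoint P0 alpha Delta t E0) /\
  ((Delta%:E < Delta_AMP P0 alpha)%E ->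
     unique_fixpoint P0 alpha Delta t E0).

Proof.
have [M0|decr] := mmse_zero_or_decreasing P0_supp.
  by split=> _; exact: unique_fixpoint_zero.
have uniq := matched_noise_unique P0_supp alpha_gt0 decr Delta_gt0 t_ge0
  Delta0_ge0 E0_ge0 E0_fix E0_fix0.
split=> // Delta_lt; apply: uniq; apply: le_lt_trans Delta_lt.
by rewrite lee_fin (matched_noise_le alpha_gt0 decr Delta_gt0 t_ge0
  Delta0_ge0 E0_ge0 E0_fix E0_fix0).
Qed.
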